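(* Let $F$ be a finite field of characteristic $2$, let $n\ge1$, let $\mathcal A$ be a commutative subalgebra of the algebra of $n\times n$ matrices over $F$, and let $A=(a_{ij})_{1\le i,j\le 3}$ be a $3\times 3$ matrix with entries $a_{ij}\in\mathcal A$, acting in $V_1\oplus V_2\oplus V_3$, $V_i=F^n$. Let $R$ be the $2\times2\times2$ block made of copies of $A$, and assume $$d=\det(a_{12}a_{23}a_{31}-a_{13}a_{32}a_{21})\ne0 .$$ Let $\varepsilon_1,\dots,\varepsilon_n$ be the standard basis of rows in $F^n$, and for $i=1,2,3$ let $\mathsf f^{(i)},\mathsf e_1^{(i)},\mathsf e_2^{(i)},\mathsf e_3^{(i)}$ be the four block rows (each an $n\times 4n$ matrix over $F$) given in the context. Then for each $i$ the $4n$ rows $\varepsilon_r\mathsf f^{(i)},\ \varepsilon_r\mathsf e_1^{(i)},\ \varepsilon_r\mathsf e_2^{(i)},\ \varepsilon_r\mathsf e_3^{(i)}$ ($r=1,\dots,n$) form a basis of the $4n$-dimensional thick space $\mathbf V_i$, and in these bases $R$ acts as the direct sum of block matrices $$\begin{pmatrix} a_{11}^2 & a_{21}^2 & a_{31}^2 \\ a_{12}^2 & a_{22}^2 & a_{32}^2 \\ a_{13}^2 & a_{23}^2 & a_{33}^2 \end{pmatrix}\;\oplus\;\mathbf 1_3\otimes\begin{pmatrix} a_{11}^2 & a_{12}^2 & a_{13}^2 \\ a_{21}^2 & a_{22}^2 & a_{23}^2 \\ a_{31}^2 & a_{32}^2 & a_{33}^2 \end{pmatrix}$$ (the $n\times n$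 blocks $a_{ij}^2$ themselves are not transposed); that is, $\varepsilon_r\mathsf f^{(i)}R=\sum_{j}\varepsilon_r a_{ji}^2\,\mathsf f^{(j)}$ and $\varepsilon_r\mathsf e_s^{(i)}R=\sum_{j}\varepsilon_r a_{ij}^2\,\mathsf e_s^{(j)}$ for all $i,s\in\{1,2,3\}$ and all $r$.
   Context: Conventions: vectors are rows and operators/matrices act from the right, so in a product the leftmost factor is applied first. Block. Let $C=\{0,1\}^3\subset\mathbb Z^3$. To every straight line parallel to the $i$-th axis through points of $C$ attach a copy of $V_i$. To every $\mathbf x\in C$ attach a copy $A^{(\mathbf x)}$ of $A$ acting in the direct sum of the copies of $V_1,V_2,V_3$ attached to the three lines meeting at $\mathbf x$, extended by the identity to the other copies. The $2\times2\times2$ block is $R=\prod_{\mathbf x\in C}A^{(\mathbf x)}$, in any order such that $A^{(\mathbf x)}$ stands to the left of $A^{(\mathbf y)}$ whenever $\mathbf x\ne\mathbf y$ and $x_i\le y_i$ for all $i$ (the result does not depend on this choice). The thick space $\mathbf V_i$ is the direct sum of the four copies of $V_i$ attached to lines parallel to the $i$-th axis; $R$ acts in $\mathbf V_1\oplus\mathbf V_2\oplus\mathbf V_3$. The four components (each in $F^n$) of a vector in $\mathbf V_i$ correspond to the lines ordered lexicographically, $(0,0),(0,1),(1,0),(1,1)$, by their two constant coordinates: $(x_2,x_3)$ for $\mathbf V_1$, $(x_1,x_3)$ for $\mathbf V_2$, $(x_1,x_2)$ for $\mathbf V_3$. Block rows (each of the four entries is an $n\times n$ matrix; $0$ and $1$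 are the zero and identity $n\times n$ matrices). For $\mathbf V_1$: $\mathsf f^{(1)}=\bigl(a_{21}a_{31},\ a_{31}(a_{21}a_{33}+a_{23}a_{31}),\ a_{21}(a_{21}a_{32}+a_{22}a_{31}),\ (a_{21}a_{33}+a_{23}a_{31})(a_{21}a_{32}+a_{22}a_{31})\bigr)$, $\mathsf e_1^{(1)}=(0,0,a_{12},a_{12}a_{33}+a_{13}a_{32})$, $\mathsf e_2^{(1)}=(0,a_{13},0,a_{12}a_{23}+a_{13}a_{22})$, $\mathsf e_3^{(1)}=(1,a_{33},a_{22},a_{22}a_{33}+a_{23}a_{32})$. For $\mathbf V_2$: $\mathsf f^{(2)}=\bigl(a_{12}a_{32},\ a_{32}(a_{12}a_{33}+a_{13}a_{32}),\ a_{12}(a_{11}a_{32}+a_{12}a_{31}),\ (a_{12}a_{33}+a_{13}a_{32})(a_{11}a_{32}+a_{12}a_{31})\bigr)$, $\mathsf e_1^{(2)}=(1,a_{33},a_{11},a_{11}a_{33}+a_{13}a_{31})$, $\mathsf e_2^{(2)}=(0,a_{23},0,a_{11}a_{23}+a_{13}a_{21})$, $\mathsf e_3^{(2)}=(0,0,a_{21},a_{21}a_{33}+a_{23}a_{31})$. For $\mathbf V_3$: $\mathsf f^{(3)}=\bigl(a_{13}a_{23},\ a_{23}(a_{12}a_{23}+a_{13}a_{22}),\ a_{13}(a_{11}a_{23}+a_{13}a_{21}),\ (a_{12}a_{23}+a_{13}a_{22})(a_{11}a_{23}+a_{13}a_{21})\bigr)$, $\mathsf e_1^{(3)}=(0,a_{32},0,a_{11}a_{32}+a_{12}a_{31})$,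 $\mathsf e_2^{(3)}=(1,a_{22},a_{11},a_{11}a_{22}+a_{12}a_{21})$, $\mathsf e_3^{(3)}=(0,0,a_{31},a_{21}a_{32}+a_{22}a_{31})$. *)

(* Defs.v *)
From HB Require Import structures.
From mathcomp Require Import all_boot all_order all_algebra.

Set Implicit Arguments.
Unset Strict Implicit.
Unset Printing Implicit Defensive.

Import GRing.Theory.
Local Open Scope ring_scope.

Notation ax1 := (@Ordinal 3 0 isT) (only parsing).
Notation ax2 := (@Ordinal 3 1 isT) (only parsing).
Notation ax3 := (@Ordinal 3 2 isT) (only parsing).

Definition cube := {ffun 'I_3 -> bool}.

Definition cube_le (x y : cube) : bool := [forall i, x i ==> y i].

(* [lift i 0 < lift i 1] are the two axes other than [i]; the line through [x]
   parallel to axis [i] gets the lexicographic rank of the corresponding pair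
   of constant coordinates. *)
Definition line (i : 'I_3) (x : cube) : 'I_4 :=
  inord ((x (lift i (0 : 'I_2))).*2 + x (lift i (1 : 'I_2))).

(* The linear extensions of [cube_le]: the orders allowed in the product. *)
Definition admissible (s : seq cube) : Prop :=
  perm_eq s (enum {: cube}) /\
  forall x y : cube, x != y -> cube_le x y -> (index x s < index y s)%N.

Section Block.

Context {F : finFieldType} {n : nat}.

Implicit Type a : 'M['M[F]_n]_3.

Definition thick : Type := 'rV[F]_(\sum_(k < 4) n).

Definition total : Type := {ffun 'I_3 -> 'rV[F]_(\sum_(k < 4) n)}.

Definition component (v : total) (i : 'I_3) (k : 'I_4) : 'rV[F]_n :=
  submxrow (v i) k.

Definition inj_thick (i : 'I_3) (u : thick) : total :=
  [ffun j => if j == i then u else 0].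

(* Row vectors: the output in direction [j] is [\sum_i v_i a_ij]. *)
Definition site_op a (x : cube) (v : total) : total :=
  [ffun j => \mxrow_(k < 4)
     if k == line j x then \sum_i component v i (line i x) *m a i j
     else component v j k].

(* The head of [s] is the leftmost factor, which is applied first. *)
Definition block_op a (s : seq cube) (v : total) : total :=
  foldl (fun w x => site_op a x w) v s.

Definition block_row (b0 b1 b2 b3 : 'M[F]_n) : 'M[F]_(n, \sum_(k < 4) n) :=
  \mxrow_(k < 4) tnth [tuple b0; b1; b2; b3] k.

Definition frow a (i : 'I_3) : 'M[F]_(n, \sum_(k < 4) n) :=
  let a11 := a ax1 ax1 in let a12 := a ax1 ax2 in let a13 := a ax1 ax3 in
  let a21 := a ax2 ax1 in let a22 := a ax2 ax2 in let a23 := a ax2 ax3 in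
  let a31 := a ax3 ax1 in let a32 := a ax3 ax2 in let a33 := a ax3 ax3 in
  tnth
    [tuple
      block_row (a21 * a31)
                (a31 * (a21 * a33 + a23 * a31))
                (a21 * (a21 * a32 + a22 * a31))
                ((a21 * a33 + a23 * a31) * (a21 * a32 + a22 * a31));
      block_row (a12 * a32)
                (a32 * (a12 * a33 + a13 * a32))
                (a12 * (a11 * a32 + a12 * a31))
                ((a12 * a33 + a13 * a32) * (a11 * a32 + a12 * a31));
      block_row (a13 * a23)
                (a23 * (a12 * a23 + a13 * a22))
                (a13 * (a11 * a23 + a13 * a21))
                ((a12 * a23 + a13 * a22) * (a11 * a23 + a13 * a21))] i.

(* [erow a i s] is the row e_s for the thick space of axis [i]. *)
Definition erow a (i s : 'I_3) : 'M[F]_(n, \sum_(k < 4) n) :=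
  let a11 := a ax1 ax1 in let a12 := a ax1 ax2 in let a13 := a ax1 ax3 in
  let a21 := a ax2 ax1 in let a22 := a ax2 ax2 in let a23 := a ax2 ax3 in
  let a31 := a ax3 ax1 in let a32 := a ax3 ax2 in let a33 := a ax3 ax3 in
  tnth (tnth
    [tuple
      [tuple block_row 0 0 a12 (a12 * a33 + a13 * a32);
             block_row 0 a13 0 (a12 * a23 + a13 * a22);
             block_row 1 a33 a22 (a22 * a33 + a23 * a32)];
      [tuple block_row 1 a33 a11 (a11 * a33 + a13 * a31);
             block_row 0 a23 0 (a11 * a23 + a13 * a21);
             block_row 0 0 a21 (a21 * a33 + a23 * a31)];
      [tuple block_row 0 a32 0 (a11 * a32 + a12 * a31);
             block_row 1 a22 a11 (a11 * a22 + a12 * a21);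
             block_row 0 0 a31 (a21 * a32 + a22 * a31)]] i) s.

Definition eps (r : 'I_n) : 'rV[F]_n := delta_mx 0 r.

Definition thick_basis a (i : 'I_3) : seq 'rV[F]_(\sum_(k < 4) n) :=
  [seq eps r *m frow a i | r <- enum 'I_n] ++
  [seq eps r *m erow a i s | s <- enum 'I_3, r <- enum 'I_n].

End Block.

(* Main.v *)
Require Import Defs.
From HB Require Import structures.
From mathcomp Require Import all_boot all_order all_algebra ring.

Set Implicit Arguments.
Unset Strict Implicit.
Unset Printing Implicit Defensive.

Import GRing.Theory.
Local Open Scope ring_scope.

(** ** Why the block acts through squares

    Every line of the cube meets two sites, and a vector goes along it in
    three stages: as it enters, between the two sites, and as it leaves.  A
    family [g x j] of vectors leaving each site [x] along each axis [j], such
    that every site turns what reaches it into what leaves it, determines the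
    action of the block: whatever the admissible order of the factors, the
    state after a prefix of the product holds on each line the vector of the
    stage that this line has reached ([block_op_prefix], [block_op_flow]).  So
    the order of the product never matters, and [R] is the sum over the
    monotone paths through the cube of the products of the entries met.

    All entries lie in a commutative ring [T] of matrices
    ([comm_subring_of]), in which [2 = 0], and the inputs of interest are
    [eps r] times elements of [T].  The action of [R] on them is therefore a
    matter of polynomial identities in nine commuting variables [A i j]
    ([output_fcoef], [output_ecoef]).

    The identities for the rows [e] have the following reason.  Write
    [l_k = \sum_j A k j * t_j], and for a multiset [M] of axes with
    multiplicities [m_k] let [G_M] be the product of the divided powers
    [l_k ^ m_k / m_k!], with [G_M = 0] if some multiplicity is negative.  Fix
    an axis [q].  On a line parallel to [i] whose constant coordinates equal
    to 1 form the set [X], the row [e_q] has the coefficient of [t^X] in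
    [G_(X + i - q)].  If only the copy of [e_q] for the axis [i] enters, then
    the vector leaving the site with set of ones [Y] along [j] is the
    coefficient of [t^Y] in the derivative of [G_(Y + 2 i - q)] by [t_j]:
    the site rule is the product rule, by which the derivative of [G_M] is
    the sum of the [A k j * G_(M - k)].  If [j] is in [Y], so that the
    vector leaves the block, this coefficient is twice that of [t^Y * t_j] in
    [G_(Y + 2 i - q)].  Modulo 2 the only contribution is that of
    [t_j^2 * (A i j)^2 / 2] in the divided square of [l_i]; it leaves
    [(A i j)^2] times the coefficient of [t^(Y - j)] in [G_(Y - q)], which is
    the entry of the row [e_q] for the axis [j].  Squares appear because twice
    a divided square is a square.

    The rows [f] supply the three dimensions that remain.  For each axis the
    coefficients of [f] and of the three rows [e] form a 4 x 4 matrix over [T]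
    with determinant the square of
    [A12 * A23 * A31 - A13 * A32 * A21] ([det_coef_mx]).  By hypothesis that
    element is an invertible matrix, and the adjugate then expresses every
    vector through the proposed basis ([thick_basis_basis]). *)

(** * Commutative subrings as rings *)

Section CommSubring.

Variables (R : pzRingType) (S : {pred R}).
Hypothesis S_subring : GRing.subring_closed S.
Hypothesis S_comm : {in S &, forall b c : R, b * c = c * b}.

(** The closure and commutation proofs are arguments so that the ring structure
    can be inferred from the type. *)
Definition comm_subring_of
  of GRing.subring_closed S & {in S &, forall b c : R, b * c = c * b} :=
  {x : R | x \in S}.
Local Notation comm_subring := (comm_subring_of S_subring S_comm).

HB.instance Definition _ := Choice.on comm_subring.
HB.instance Definition _ := SubType.on comm_subring.
HB.instance Definition _ :=
  GRing.SubChoice_isSubPzRing.Build R S comm_subring S_subring.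

Fact comm_subring_mulC : commutative (@GRing.mul comm_subring).
Proof.
by move=> x y; apply: val_inj; rewrite !rmorphM; apply: S_comm; apply: valP.
Qed.

HB.instance Definition _ :=
  GRing.PzSemiRing_hasCommutativeMul.Build comm_subring comm_subring_mulC.

End CommSubring.

(** * The lines and sites of the cube *)

Lemma axis_ind (P : 'I_3 -> Prop) : P ax1 -> P ax2 -> P ax3 -> forall i, P i.
Proof.
by move=> P1 P2 P3 [[|[|[|//]]] lt_i3]; rewrite (bool_irrelevance lt_i3 isT).
Qed.

Lemma ord4_ind (P : 'I_4 -> Prop) :
    P (@Ordinal 4 0 isT) -> P (@Ordinal 4 1 isT) -> P (@Ordinal 4 2 isT) ->
    P (@Ordinal 4 3 isT) ->
  forall k, P k.
Proof.
move=> P0 P1 P2 P3 [[|[|[|[|//]]]] lt_k4];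
  by rewrite (bool_irrelevance lt_k4 isT).
Qed.

Lemma big_axes (V : nmodType) (G : 'I_3 -> V) :
  \sum_i G i = G ax1 + G ax2 + G ax3.
Proof.
rewrite !big_ord_recl big_ord0 addr0 addrA.
by congr (G _ + G _ + G _); apply: val_inj.
Qed.

Local Notation other0 i := (lift i (0%R : 'I_2)).
Local Notation other1 i := (lift i (1%R : 'I_2)).

Lemma lift_axes :
  ((other0 ax1 = ax2) * (other1 ax1 = ax3)
   * (other0 ax2 = ax1) * (other1 ax2 = ax3)
   * (other0 ax3 = ax1) * (other1 ax3 = ax2))%type.
Proof. by do !split; apply: val_inj. Qed.

Section Lines.
Implicit Types (i : 'I_3) (x y : cube).

Definition low i x : cube := [ffun j => (j != i) && x j].
Definition high i x : cube := [ffun j => (j == i) || x j].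

Lemma low_id i x : ~~ x i -> low i x = x.
Proof.
move=> /negPf xi; apply/ffunP=> j; rewrite ffunE.
by case: eqP => [->|] //=; rewrite xi.
Qed.

Lemma high_id i x : x i -> high i x = x.
Proof.
move=> xi; apply/ffunP=> j; rewrite ffunE.
by case: eqP => [->|] //=; rewrite xi.
Qed.

Lemma low_lt_high i x : (low i x != high i x) && cube_le (low i x) (high i x).
Proof.
apply/andP; split.
  by apply/eqP => /ffunP/(_ i); rewrite !ffunE eqxx.
by apply/forallP => j; rewrite !ffunE; case: (j == i); rewrite ?implybb.
Qed.

Lemma lineE i x :
  (line i x : nat) = ((x (other0 i)).*2 + x (other1 i))%N.
Proof. by rewrite inordK //; do 2!case: (x _). Qed.

Lemma line_bits i x :
  ((1 < line i x)%N = x (other0 i))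
  * (odd (line i x) = x (other1 i)).
Proof. by rewrite lineE; split; do 2!case: (x _). Qed.

Lemma eq_line i x y :
  line i x = line i y -> low i x = low i y /\ high i x = high i y.
Proof.
move=> eq_xy; have [b0 b1] := line_bits i x; have [c0 c1] := line_bits i y.
rewrite eq_xy c0 c1 in b0 b1.
have eq_j j : j != i -> x j = y j.
  elim/axis_ind: i {eq_xy c0 c1} b0 b1 => b0 b1; elim/axis_ind: j => //= _;
  by rewrite !lift_axes in b0 b1.
by split; apply/ffunP=> j; rewrite !ffunE; case: eqVneq => //= /eq_j.
Qed.

Lemma line_low i x : line i (low i x) = line i x.
Proof.
apply: val_inj; rewrite /= !lineE !ffunE.
by rewrite ![lift _ _ == _]eq_sym !(negbTE (neq_lift _ _)).
Qed.

Lemma line_high i x : line i (high i x) = line i x.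
Proof.
apply: val_inj; rewrite /= !lineE !ffunE.
by rewrite ![lift _ _ == _]eq_sym !(negbTE (neq_lift _ _)).
Qed.

Lemma line_surj i (k : 'I_4) : exists x, line i x = k.
Proof.
exists [ffun j => if j == other0 i then (1 < k)%N else odd k].
apply: val_inj; rewrite /= lineE !ffunE eqxx.
rewrite (inj_eq lift_inj) /=.
by case: k => [[|[|[|[|]]]]].
Qed.

End Lines.

(** * Independence of the order of the factors *)

Section Flow.
Context {F : finFieldType} {n : nat}.
Variables (a : 'M['M[F]_n]_3) (v : @Defs.total F n).
Implicit Types (i j : 'I_3) (x y : cube) (s : seq cube).

Lemma component_site_op y (u : Defs.total) i x :
  component (site_op a y u) i (line i x) =
  if line i x == line i y then \sum_k component u k (line k y) *m a k i
  else component u i (line i x).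
Proof. by rewrite /component /site_op ffunE mxrowK. Qed.

Variable g : cube -> 'I_3 -> 'rV[F]_n.
Hypothesis g_flow : forall x j,
  g x j = \sum_i
    (if x i then g (low i x) i else component v i (line i x)) *m a i j.

(** The invariant of the product: a line carries the vector of the last of its
    sites already passed.  Since the low site of a line precedes its high site
    in every admissible order, a site always receives from each of its three
    lines the vector which [g] expects. *)
Lemma block_op_prefix o p t : admissible o -> o = p ++ t -> forall i x,
  component (block_op a p v) i (line i x) =
  if high i x \in p then g (high i x) i
  else if low i x \in p then g (low i x) i
  else component v i (line i x).
Proof.
move=> [o_enum o_order]; elim/last_ind: p t => [//|p y IHp] t o_eq i x.
have o_uniq : uniq o by rewrite (perm_uniq o_enum) enum_uniq.
have o_split : o = p ++ y :: t by rewrite o_eq cat_rcons.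
have {}IHp := IHp _ o_split.
have yp : y \notin p.
  by move: o_uniq; rewrite o_split cat_uniq /= => /and3P[_ /norP[]].
have lowhigh k z : (index (low k z) o < index (high k z) o)%N.
  by have /andP[neq le] := low_lt_high k z; apply: o_order.
have index_y : index y o = size p.
  by rewrite o_split index_cat (negbTE yp) /= eqxx addn0.
have before z : (index z o < size p)%N -> z \in p.
  by rewrite o_split index_cat; case: ifP => // _; rewrite ltnNge leq_addr.
have after z : (size p < index z o)%N -> z \notin p.
  rewrite o_split index_cat; case: ifP => // zp.
  by rewrite ltnNge (ltnW _) // index_mem.
have arrive k : component (block_op a p v) k (line k y) =
                if y k then g (low k y) k else component v k (line k y).
  rewrite IHp; have [yk|yk] := boolP (y k).
    rewrite (high_id yk) (negbTE yp) before //.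
    by rewrite -index_y -{2}(high_id yk) lowhigh.
  rewrite (low_id yk) (negbTE yp) (negbTE (after _ _)) //.
  by rewrite -index_y -{1}(low_id yk) lowhigh.
rewrite /block_op -cats1 foldl_cat /= -/(block_op a p v) component_site_op.
rewrite !mem_cat !mem_seq1; case: eqP => [/eq_line[-> ->]|neq_line].
  rewrite (eq_bigr _ (fun k _ => congr1 (mulmx^~ (a k i)) (arrive k))) -g_flow.
  have [yi|yi] := boolP (y i).
    by rewrite (high_id yi) eqxx orbT.
  rewrite (low_id yi) eqxx orbT (negbTE (after _ _)) /=; last first.
    by rewrite -index_y -{1}(low_id yi) lowhigh.
  by case: eqP => [eq_y|//]; rewrite eq_y.
have /negPf-> : high i x != y.
  by apply/eqP => eq_y; apply: neq_line; rewrite -eq_y line_high.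
have /negPf-> : low i x != y.
  by apply/eqP => eq_y; apply: neq_line; rewrite -eq_y line_low.
by rewrite IHp !orbF.
Qed.

Lemma block_op_flow o : admissible o -> forall i x,
  component (block_op a o v) i (line i x) = g (high i x) i.
Proof.
move=> o_adm i x; have [o_enum _] := o_adm.
rewrite (block_op_prefix o_adm (esym (cats0 o))).
by rewrite (perm_mem o_enum) mem_enum.
Qed.

End Flow.

(** * Polynomial identities in characteristic 2 *)

Section Algebra.

Variables (T : comPzRingType) (A : 'M[T]_3).
Implicit Types (i j q : 'I_3) (w : 'I_3 -> bool -> bool -> T).

(** The coefficient leaving the site with coordinates [b1], [b2], [b3] along
    [j] when [w] enters the block.  Every step back lowers a coordinate, so
    that three steps reach all the entrances: this is the bound [m]. *)
Fixpoint flow w m (b1 b2 b3 : bool) j : T :=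
  let earlier c1 c2 c3 i := if m is m'.+1 then flow w m' c1 c2 c3 i else 0 in
    (if b1 then earlier false b2 b3 ax1 else w ax1 b2 b3) * A ax1 j
  + (if b2 then earlier b1 false b3 ax2 else w ax2 b1 b3) * A ax2 j
  + (if b3 then earlier b1 b2 false ax3 else w ax3 b1 b2) * A ax3 j.

Lemma flow3E w b1 b2 b3 j : flow w 3 b1 b2 b3 j =
    (if b1 then flow w 3 false b2 b3 ax1 else w ax1 b2 b3) * A ax1 j
  + (if b2 then flow w 3 b1 false b3 ax2 else w ax2 b1 b3) * A ax2 j
  + (if b3 then flow w 3 b1 b2 false ax3 else w ax3 b1 b2) * A ax3 j.
Proof. by case: b1; case: b2; case: b3. Qed.

(** On a line parallel to [j], what leaves the block is what leaves the site
    with coordinate 1 on the axis [j]. *)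
Definition output w j (b c : bool) : T :=
  nth 0 [:: flow w 3 true b c j; flow w 3 b true c j; flow w 3 b c true j] j.

Definition input_at i (u : bool -> bool -> T) k b c : T :=
  if k == i then u b c else 0.

(** The row [f] is a tensor product: [b] and [c] are the coordinates on the two
    axes other than [i], in increasing order, and each has its own factor. *)
Definition fcoef i (b c : bool) : T :=
  let j := other0 i in let k := other1 i in
  (if b then A j i * A k j + A j j * A k i else A k i) *
  (if c then A k i * A j k + A k k * A j i else A j i).

(** If [X] is the set of axes other than [i] with coordinate 1, this is the
    minor of [A] with columns [X] and rows [X] and [i] without [q], and zero if
    [q] is neither in [X] nor equal to [i]; signs do not matter. *)
Definition ecoef q i (b c : bool) : T :=
  let j := other0 i in let k := other1 i in
  if q == i then
    if b then if c then A j j * A k k + A j k * A k j else A j j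
    else if c then A k k else 1
  else if q == j then
    if b then if c then A i j * A k k + A i k * A k j else A i j else 0
  else
    if c then if b then A i k * A j j + A i j * A j k else A i k else 0.

Hypothesis two_eq0 : 2%:R = 0 :> T.

Lemma opprE (x : T) : - x = x.
Proof. by apply: addr0_eq; rewrite -mulr2n -mulr_natl two_eq0 mul0r. Qed.

Lemma char2_eq (x y : T) : x + y = 0 -> x = y.
Proof. by move/addr0_eq; rewrite opprE. Qed.

Lemma even0 m : (2 * m)%:R = 0 :> T.
Proof. by rewrite natrM two_eq0 mul0r. Qed.

(* [ring] uses a hypothesis [m%:R = 0] only on monomials of coefficient [m];
   the even coefficients listed here are those that occur once both sides of
   an identity are added up. *)
Ltac ring2 := apply: char2_eq; ring: (even0 1) (even0 2) (even0 3).

(** The sum over the paths agrees with the right-hand side monomial by monomial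
    modulo 2.  The index order [A j i], opposite to that in [output_ecoef], is
    the source of the transposed summand of the block. *)
Lemma output_fcoef i j b c :
  output (input_at i (fcoef i)) j b c = A j i ^+ 2 * fcoef j b c.
Proof.
elim/axis_ind: i; elim/axis_ind: j; case: b; case: c;
  rewrite /output /fcoef /input_at !lift_axes /=; ring2.
Qed.

(** The coefficient of [t_j^2] in a divided square, doubled, gives
    [A i j ^+ 2]; as the number of paths is small, expansion proves it
    directly. *)
Lemma output_ecoef q i j b c :
  output (input_at i (ecoef q i)) j b c = A i j ^+ 2 * ecoef q j b c.
Proof.
elim/axis_ind: q; elim/axis_ind: i; elim/axis_ind: j; case: b; case: c;
  rewrite /output /ecoef /input_at !lift_axes /=; ring2.
Qed.

Definition coef_mx i : 'M[T]_4 := \matrix_(l, k)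
  nth (fun _ _ => 0) [:: fcoef i; ecoef ax1 i; ecoef ax2 i; ecoef ax3 i] l
    (1 < k)%N (odd k).

Lemma det_coef_mx i : \det (coef_mx i) =
  (A ax1 ax2 * A ax2 ax3 * A ax3 ax1 - A ax1 ax3 * A ax3 ax2 * A ax2 ax1) ^+ 2.
Proof.
do 3!rewrite ?(expand_det_row _ ord0) ?big_ord_recl ?big_ord0 /cofactor.
rewrite !det_mx11 !mxE /= !opprE !expr1n.
elim/axis_ind: i; rewrite /fcoef /ecoef !lift_axes /=; ring2.
Qed.

End Algebra.

(** * From coefficients to thick spaces *)

Section Assembly.

Context {F : finFieldType} {n : nat} {T : comPzRingType}.
Variables (rho : {rmorphism T -> 'M[F]_n}) (A : 'M[T]_3).
Variable a : 'M['M[F]_n]_3.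
Hypothesis aE : forall i j, a i j = rho (A i j).
Implicit Types (i j s : 'I_3) (r : 'I_n).

(** The two bits of the rank [k] of a line are its constant coordinates. *)
Definition embed_row (u : bool -> bool -> T) : 'M[F]_(n, \sum_(k < 4) n) :=
  \mxrow_(k < 4) rho (u (1 < k)%N (odd k)).

Definition embed r (w : 'I_3 -> bool -> bool -> T) : @Defs.total F n :=
  [ffun i => eps r *m embed_row (w i)].

Lemma eq_embed r w1 w2 : (forall i b c, w1 i b c = w2 i b c) ->
  embed r w1 = embed r w2.
Proof.
move=> eq_w; apply/ffunP=> i; rewrite !ffunE; congr (_ *m _).
by apply: eq_mxrow => k; rewrite eq_w.
Qed.

Lemma component_embed r w i x :
  component (embed r w) i (line i x) =
  eps r *m rho (w i (x (other0 i)) (x (other1 i))).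
Proof. by rewrite /component ffunE -mul_submxrow mxrowK !line_bits. Qed.

(** On vectors with coefficients in [T] the block acts by sums over paths. *)
Lemma block_op_embed o r w : admissible o ->
  block_op a o (embed r w) = embed r (output A w).
Proof.
move=> o_adm.
pose g (x : cube) j := eps r *m rho (flow A w 3 (x ax1) (x ax2) (x ax3) j).
have g_flow x j : g x j = \sum_i
    (if x i then g (low i x) i else component (embed r w) i (line i x))
      *m a i j.
  rewrite {1}/g flow3E !rmorphD !rmorphM -!mulmxE !mulmxDr !mulmxA -!aE.
  rewrite big_axes !component_embed !lift_axes /g !ffunE.
  by case: (x ax1); case: (x ax2); case: (x ax3).
apply/ffunP=> j; apply/mxrowP => k; have [x <-] := line_surj j k.
rewrite -/(component _ _ _) (block_op_flow g_flow o_adm) -/(component _ _ _).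
rewrite component_embed /g !ffunE.
by elim/axis_ind: j; rewrite /output !lift_axes.
Qed.

Lemma inj_embed_row r i u :
  inj_thick i (eps r *m embed_row u) = embed r (input_at i u).
Proof.
apply/ffunP=> j; rewrite !ffunE /input_at; case: eqP => // _.
by rewrite /embed_row (eq_mxrow (fun k => rmorph0 rho)) mxrow0 mulmx0.
Qed.

Lemma sum_inj_embed r (c : 'I_3 -> T) (u : 'I_3 -> bool -> bool -> T) :
  \sum_j inj_thick j (eps r *m rho (c j) *m embed_row (u j)) =
  embed r (fun j b d => c j * u j b d).
Proof.
apply/ffunP=> j; rewrite sum_ffunE (bigD1 j) //=.
rewrite [X in _ + X]big1 => [|k /negPf neq_kj].
  rewrite [LHS]addr0 !ffunE eqxx -mulmxA mul_mxrow; congr (_ *m _).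
  by apply: eq_mxrow => k; rewrite rmorphM mulmxE.
by rewrite ffunE eq_sym neq_kj.
Qed.

Lemma frow_embed i : frow a i = embed_row (fcoef A i).
Proof.
elim/axis_ind: i; apply/mxrowP; elim/ord4_ind; rewrite /frow /= !mxrowK /=.
all: rewrite !aE -!(rmorphM, rmorphD) /fcoef !lift_axes.
all: by congr (rho _) => /=; ring.
Qed.

(** [erow a i s] is marked by the axis after [s] in the cyclic order of the
    three axes. *)
Lemma erow_embed i s : erow a i s = embed_row (ecoef A (s + 1) i).
Proof.
elim/axis_ind: s; elim/axis_ind: i; apply/mxrowP; elim/ord4_ind;
  rewrite /erow /= !mxrowK /=.
all: rewrite ?aE -?(rmorphM, rmorphD) /ecoef !lift_axes /=.
all: rewrite ?(rmorph0, rmorph1) //.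
all: by congr (rho _); ring.
Qed.

Hypothesis two_eq0 : 2%:R = 0 :> T.

Lemma block_op_frow o i r : admissible o ->
  block_op a o (inj_thick i (eps r *m frow a i)) =
  \sum_(j < 3) inj_thick j (eps r *m (a j i ^+ 2) *m frow a j).
Proof.
move=> o_adm; rewrite frow_embed inj_embed_row block_op_embed //.
under eq_bigr do rewrite aE -rmorphXn frow_embed.
by rewrite sum_inj_embed; apply: eq_embed => j b c; rewrite output_fcoef.
Qed.

Lemma block_op_erow o i s r : admissible o ->
  block_op a o (inj_thick i (eps r *m erow a i s)) =
  \sum_(j < 3) inj_thick j (eps r *m (a i j ^+ 2) *m erow a j s).
Proof.
move=> o_adm; rewrite erow_embed inj_embed_row block_op_embed //.
under eq_bigr do rewrite aE -rmorphXn erow_embed.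
by rewrite sum_inj_embed; apply: eq_embed => j b c; rewrite output_ecoef.
Qed.

Let delta :=
  A ax1 ax2 * A ax2 ax3 * A ax3 ax1 - A ax1 ax3 * A ax3 ax2 * A ax2 ax1.

(** The adjugate of [coef_mx A i] inverts it up to the factor [delta ^+ 2],
    which [rho] sends to an invertible matrix; so the [4 * n] vectors span. *)
Lemma thick_basis_basis i : rho delta \in unitmx ->
  basis_of {:'rV[F]_(\sum_(k < 4) n)} (thick_basis a i).
Proof.
move=> delta_unit; rewrite basisEdim; apply/andP; split; last first.
  have -> : \dim {:'rV[F]_(\sum_(k < 4) n)} = (4 * n)%N.
    by rewrite dimvf dim_matrix mul1r sum_nat_const card_ord.
  by rewrite /thick_basis size_cat size_allpairs size_map !size_enum_ord -mulSn.
have frow_span y : y *m frow a i \in <<thick_basis a i>>%VS.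
  rewrite (row_sum_delta y) mulmx_suml memv_suml // => r _.
  rewrite -scalemxAl memvZ // memv_span // mem_cat.
  by apply/orP; left; apply: map_f; rewrite mem_enum.
have erow_span s y : y *m erow a i s \in <<thick_basis a i>>%VS.
  rewrite (row_sum_delta y) mulmx_suml memv_suml // => r _.
  rewrite -scalemxAl memvZ // memv_span // mem_cat.
  by apply/orP; right; apply: allpairs_f; rewrite mem_enum.
apply/subvP => v _.
pose B l := embed_row (nth (fun _ _ => 0)
  [:: fcoef A i; ecoef A ax1 i; ecoef A ax2 i; ecoef A ax3 i] (l : 'I_4)).
have B_span l y : y *m B l \in <<thick_basis a i>>%VS.
  elim/ord4_ind: l; rewrite /B /=.
  - by rewrite -frow_embed.
  - by rewrite (_ : ax1 = ax3 + 1) -?erow_embed //; apply: val_inj.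
  - by rewrite (_ : ax2 = ax1 + 1) -?erow_embed //; apply: val_inj.
  - by rewrite (_ : ax3 = ax2 + 1) -?erow_embed //; apply: val_inj.
(* [y] is [v] divided by [rho (delta ^+ 2)], the image of the determinant. *)
pose y k := submxrow v k *m invmx (rho delta) *m invmx (rho delta).
suff -> : v = \sum_l (\sum_k y k *m rho (\adj (coef_mx A i) k l)) *m B l.
  by apply: memv_suml.
apply/mxrowP => k; rewrite submxrow_sum.
have yk : submxrow v k = y k *m rho (\det (coef_mx A i)).
  by rewrite det_coef_mx // -/delta expr2 rmorphM -mulmxE mulmxA !mulmxKV.
transitivity (\sum_j y j *m rho ((\adj (coef_mx A i) *m coef_mx A i) j k)).
  rewrite mul_adj_mx (bigD1 k) //= big1 => [|j /negPf neq_jk].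
    by rewrite mxE eqxx addr0 yk.
  by rewrite mxE neq_jk rmorph0 mulmx0.
under eq_bigr do rewrite mxE rmorph_sum mulmx_sumr.
rewrite exchange_big; apply: eq_bigr => l _ /=.
rewrite -mul_submxrow mxrowK mulmx_suml; apply: eq_bigr => j _.
by rewrite rmorphM -mulmxE mulmxA [coef_mx _ _ _ _]mxE.
Qed.

End Assembly.

Theorem proposition13 (F : finFieldType) (charF : 2%N \in [pchar F])
    (n : nat) (n_gt0 : (0 < n)%N)
    (S : {pred 'M[F]_n})
    (S_submod : GRing.submod_closed S) (S_mulr : GRing.mulr_closed S)
    (S_comm : {in S &, forall b c : 'M[F]_n, b * c = c * b})
    (a : 'M['M[F]_n]_3) (aS : forall i j, a i j \in S)
    (d_neq0 : \det (a ax1 ax2 * a ax2 ax3 * a ax3 ax1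
                    - a ax1 ax3 * a ax3 ax2 * a ax2 ax1) != 0) :
  (forall i : 'I_3, basis_of {:'rV[F]_(\sum_(k < 4) n)} (thick_basis a i)) /\
  (forall o : seq cube, admissible o ->
     (forall (i : 'I_3) (r : 'I_n),
        block_op a o (inj_thick i (eps r *m frow a i)) =
        \sum_(j < 3) inj_thick j (eps r *m (a j i ^+ 2) *m frow a j)) /\
     (forall (i s : 'I_3) (r : 'I_n),
        block_op a o (inj_thick i (eps r *m erow a i s)) =
        \sum_(j < 3) inj_thick j (eps r *m (a i j ^+ 2) *m erow a j s))).
Proof.
have [S0 S_lin] := S_submod; have [S1 SM] := S_mulr.
have S_subring : GRing.subring_closed S.
  by split=> // b c bS cS; rewrite addrC -scaleN1r; apply: S_lin.
pose T := comm_subring_of S_subring S_comm.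
pose A : 'M[T]_3 := \matrix_(i, j) Sub (a i j) (aS i j).
have aE i j : a i j = (val : T -> 'M[F]_n) (A i j) by rewrite mxE SubK.
have two_eq0 : 2%:R = 0 :> T.
  by apply: val_inj; rewrite rmorph_nat -scaler_nat pcharf0 ?scale0r.
split=> [i|o o_adm]; last split=> *.
- apply: (thick_basis_basis aE two_eq0).
  by rewrite unitmxE unitfE rmorphB !rmorphM /= !mxE !SubK.
- exact: (block_op_frow aE two_eq0).
- exact: (block_op_erow aE two_eq0).
Qed.
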